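(* Let $\{\alpha,S_0,\vartheta_1,\vartheta_2\}$ be an admissible quadruple such that the pair $\{\alpha,\vartheta_1\}$ is controllable. Then $\sigma(\alpha)\subset\mathbb{C}_+$.
   Context: $\sigma(\alpha)$ is the spectrum of $\alpha$, and $\mathbb{C}_+$ is the open upper half-plane $\{z:\Im(z)>0\}$. $X>0$ means that $X$ is Hermitian with all eigenvalues positive. Let $n,m_1,m_2\in\mathbb{N}$. A quadruple $\{\alpha,S_0,\vartheta_1,\vartheta_2\}$ of $n\times n$ matrices $\alpha,S_0$ and $n\times m_k$ matrices $\vartheta_k$ ($k=1,2$) with complex entries is admissible if $S_0>0$ and $$\alpha S_0-S_0\alpha^*=\mathrm{i}(\vartheta_1\vartheta_1^*+\vartheta_2\vartheta_2^* ).$$ The pair $\{\alpha,\vartheta_1\}$ is controllable if $\mathrm{span}\bigcup_{k=0}^{n-1}\mathrm{Im}(\alpha^k\vartheta_1)=\mathbb{C}^n$. *)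

(* Defs.v *)
From HB Require Import structures.
From mathcomp Require Import all_boot all_order all_algebra.
From mathcomp Require Import spectral complex.
From mathcomp Require Import reals.

Set Implicit Arguments.
Unset Strict Implicit.
Unset Printing Implicit Defensive.

Import Order.TTheory GRing.Theory Num.Theory.
Local Open Scope ring_scope.
Local Open Scope sesquilinear_scope.

Section Admissible.
Variable C : numClosedFieldType.

(* [0 < a] in a numClosedFieldType means that [a] is real and positive.
   [eigenvalue] is phrased with row eigenvectors; over a field this gives the
   same set as column eigenvectors. *)
Definition posdefmx n (X : 'M[C]_n) : Prop :=
  X \is hermsymmx /\ (forall a : C, eigenvalue X a -> 0 < a).

(* [^t*] is the conjugate transpose. *)
Definition admissible n m1 m2 (alpha S0 : 'M[C]_n)
    (theta1 : 'M[C]_(n, m1)) (theta2 : 'M[C]_(n, m2)) : Prop :=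
  posdefmx S0 /\
  alpha *m S0 - S0 *m alpha ^t* =
    'i *: (theta1 *m theta1 ^t* + theta2 *m theta2 ^t*).

(* The image of a matrix acting on column vectors; the row-space operations
   of mxalgebra would describe the image of its transpose. *)
Definition col_image n m (A : 'M[C]_(n, m)) : {vspace 'cV[C]_n} :=
  limg (linfun (fun v : 'cV[C]_m => A *m v)).

(* The span of a union of subspaces is their sum. *)
Definition controllable n m (alpha : 'M[C]_n) (theta : 'M[C]_(n, m)) : Prop :=
  (\sum_(k < n) col_image (alpha ^+ k *m theta))%VS = fullv.

End Admissible.

(* Main.v *)
Require Import Defs.
From mathcomp Require Import all_boot all_order all_algebra.
From mathcomp Require Import complex reals.
From mathcomp Require Import sesquilinear spectral.
Import Order.TTheory GRing.Theory Num.Theory.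
Local Open Scope ring_scope.
Local Open Scope complex_scope.

(** Pairing the identity for [alpha S0 - S0 alpha^*] with a left eigenvector
    [v] of [alpha] for [z] gives
    [2 Im z * <v S0, v> = |v theta1|^2 + |v theta2|^2], where [<v S0, v> > 0].
    If [v theta1 = 0], then [v alpha^k theta1 = z^k v theta1 = 0] for all [k],
    which contradicts controllability; so the right-hand side is positive. *)

Section Admissible.
Set Implicit Arguments.
Unset Strict Implicit.
Variable C : numClosedFieldType.
Local Open Scope ring_scope.
Local Open Scope sesquilinear_scope.

Lemma adjmxM m n p (A : 'M[C]_(m, n)) (B : 'M[C]_(n, p)) :
  (A *m B) ^t* = B ^t* *m A ^t*.
Proof. by rewrite trmx_mul map_mxM. Qed.

Lemma mulmx_adj_ge0 n (u : 'rV[C]_n) : 0 <= (u *m u ^t*) 0 0.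
Proof. by rewrite mxE sumr_ge0// => j _; rewrite !mxE mul_conjC_ge0. Qed.

Lemma mulmx_adj_gt0 n (u : 'rV[C]_n) : u != 0 -> 0 < (u *m u ^t*) 0 0.
Proof. by move=> /dotmx_is_dotmx; rewrite dotmxE. Qed.

(** Unitary diagonalization [X = invmx P *m diag_mx d *m P] turns the form into the sum of
    [d_j |w_j|^2] with [w = v *m invmx P], and every [d_j] is an eigenvalue of [X]. *)
Lemma posdefmx_gt0 n (X : 'M[C]_n) (v : 'rV[C]_n) :
  posdefmx X -> v != 0 -> 0 < (v *m X *m v ^t*) 0 0.
Proof.
case=> herX eigX v0.
have Pu := spectral_unitarymx X; have Pi := spectral_unit X.
have /hermitian_normalmx/orthomx_spectralP := herX.
set P := spectralmx X in Pu Pi *; set d := spectral_diag X => defX.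
have d_gt0 j : 0 < d 0 j.
  apply: eigX; apply/eigenvalueP; exists (row j P).
    rewrite -row_mul {1}defX !mulmxA mulmxV// mul1mx row_mul.
    by rewrite row_diag_mx -scalemxAl -rowE.
  (* The rows of a unitary matrix have norm 1, so the eigenvector [row j P] is nonzero. *)
  apply/eqP => Pj0; have /row_unitarymxP/(_ j j) := Pu.
  by rewrite Pj0 dotmxE mul0mx mxE eqxx => /esym/eqP; rewrite oner_eq0.
pose w := v *m invmx P.
have w0 : w != 0.
  by apply: contra_neq v0 => w0; rewrite -(mulmxKV Pi v) -/w w0 mul0mx.
have {defX} -> : v *m X *m v ^t* = w *m diag_mx d *m w ^t*.
  by rewrite /w adjmxM invmx_unitary// trmxCK {1}defX invmx_unitary// !mulmxA.
move: w w0 => w w0; rewrite mxE.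
under eq_bigr => j _ do rewrite mul_mx_diag !mxE mulrAC.
have /rV0Pn[j wj] := w0.
(* The term at an index with [w_j] nonzero is positive; the others are nonnegative. *)
rewrite (bigD1 j)//= ltr_wpDr//.
  by rewrite sumr_ge0// => k _; rewrite mulr_ge0 ?mul_conjC_ge0// ltW.
by rewrite mulr_gt0 ?mul_conjC_gt0.
Qed.

Lemma mulmx_expr_eigen n (A : 'M[C]_n) (v : 'rV[C]_n) (z : C) k :
  v *m A = z *: v -> v *m A ^+ k = z ^+ k *: v.
Proof.
move=> vA; elim: k => [|k IHk]; first by rewrite !expr0 mulmx1 scale1r.
by rewrite exprS mulmxA vA -scalemxAl IHk scalerA -exprS.
Qed.

(** The functional [x |-> v *m x] kills each summand of the controllable space, so its kernel is
    everything; its values on the standard basis are the entries of [v]. *)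
Lemma controllable_left_eq0 n m (A : 'M[C]_n) (B : 'M[C]_(n, m))
    (v : 'rV[C]_n) :
  controllable A B -> (forall k, v *m (A ^+ k *m B) = 0) -> v = 0.
Proof.
move=> ctrlAB vAB; pose f := linfun (fun x : 'cV[C]_n => v *m x).
have fE x : f x = v *m x by rewrite lfunE.
have kerf : (fullv <= lker f)%VS.
  rewrite -ctrlAB; apply/subv_sumP => k _; apply/subvP => x /memv_imgP[y _ ->].
  by rewrite memv_ker fE lfunE /= mulmxA vAB mul0mx.
apply/rowP => j; have := subvP kerf (delta_mx j 0) (memvf _).
by rewrite memv_ker fE -colE => /eqP/matrixP/(_ 0 0); rewrite !mxE.
Qed.

Lemma admissible_eigen n m1 m2 (alpha S0 : 'M[C]_n)
    (theta1 : 'M[C]_(n, m1)) (theta2 : 'M[C]_(n, m2)) (v : 'rV[C]_n) (z : C) :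
  admissible alpha S0 theta1 theta2 -> v *m alpha = z *: v ->
  2 * 'Im z * (v *m S0 *m v ^t*) 0 0 =
    ((v *m theta1) *m (v *m theta1) ^t*) 0 0 +
    ((v *m theta2) *m (v *m theta2) ^t*) 0 0.
Proof.
case=> _ /(congr1 (fun M => v *m M *m v ^t*)) + va.
(* With this adjoint eigenvector equation, the left-hand side becomes [z - z^*] times the form of
   [S0] at [v]. *)
have av : alpha ^t* *m v ^t* = z^* *: v ^t*.
  by rewrite -adjmxM va linearZ /= map_mxZ.
rewrite mulmxBr mulmxBl !mulmxA va -(mulmxA _ (alpha ^t*)) av.
rewrite -!scalemxAl -!scalemxAr -scalerBl -scalemxAl.
move=> /matrixP/(_ 0 0); rewrite mxE.
rewrite [RHS]mxE mulmxDr mulmxDl [X in _ = 'i * X]mxE !adjmxM !mulmxA => eqz.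
(* After multiplication by ['i], what remains is ['i * (2 * 'Im z) = z - z^*]. *)
apply: (mulfI (neq0Ci C)); rewrite -eqz mulrA; congr (_ * _).
by rewrite ImE (mulrC 2) divfK ?pnatr_eq0// mulrA mulCii mulN1r opprB.
Qed.

Lemma controllable_admissible_Im_gt0 n m1 m2 (alpha S0 : 'M[C]_n)
    (theta1 : 'M[C]_(n, m1)) (theta2 : 'M[C]_(n, m2)) (z : C) :
  admissible alpha S0 theta1 theta2 -> controllable alpha theta1 ->
  eigenvalue alpha z -> 0 < 'Im z.
Proof.
move=> adm ctrl /eigenvalueP[v va v0].
have vS_gt0 := posdefmx_gt0 adm.1 v0.
have vth0 : v *m theta1 != 0.
  apply: contra_neq v0 => vth0; apply: controllable_left_eq0 ctrl _ => k.
  by rewrite mulmxA (mulmx_expr_eigen _ va) -scalemxAl vth0 scaler0.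
have : 0 < 2 * 'Im z * (v *m S0 *m v ^t*) 0 0.
  by rewrite (admissible_eigen adm va) ltr_wpDr ?mulmx_adj_ge0 ?mulmx_adj_gt0.
by rewrite pmulr_lgt0// pmulr_rgt0.
Qed.

End Admissible.

Theorem lemma2p10 (R : realType) (n m1 m2 : nat)
    (alpha S0 : 'M[R[i]]_n)
    (theta1 : 'M[R[i]]_(n, m1)) (theta2 : 'M[R[i]]_(n, m2))
    (hadm : admissible alpha S0 theta1 theta2)
    (hctrl : controllable alpha theta1) :
  forall z : R[i], eigenvalue alpha z -> 0 < complex.Im z.
Proof.
move=> z /(controllable_admissible_Im_gt0 hadm hctrl).
(* ['Im z] is an element of [R[i]], namely the embedding of the real number [complex.Im z], and the
   embedding reflects the strict order. *)
by rewrite -complexIm ltcR.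
Qed.
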